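(* For every integer $n\ge1$ there exists an irreducible generalized conformal module over the Virasoro conformal algebra $Vir$ that is free of rank $n$ as a $\mathbb{C}[\partial]$-module.
   Context: The Virasoro conformal algebra is $Vir=\mathbb{C}[\partial]L$ with $[L_\lambda L]=(\partial+2\lambda)L$. A generalized conformal module $V$ over $Vir$ is a $\mathbb{C}[\partial]$-module with a linear map $L_\lambda:V\to V[[\lambda]]$ such that $L_\lambda(\partial v)=(\partial+\lambda)L_\lambda v$ and $L_\lambda(L_\mu v)-L_\mu(L_\lambda v)=(\lambda-\mu)L_{\lambda+\mu}v$ in $V[[\lambda,\mu]]$ for all $v\in V$ ($L_\lambda$ extended coefficientwise to power series). A submodule is a $\mathbb{C}[\partial]$-submodule $W$ with $L_\lambda W\subseteq W[[\lambda]]$; $V$ is irreducible if $V\ne0$ and its only submodules are $0$ and $V$. *)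

(* Defs.v *)
From HB Require Import structures.
From mathcomp Require Import all_boot all_order all_algebra.
From mathcomp Require Import complex.
From mathcomp Require Import classical_sets reals.

Set Implicit Arguments.
Unset Strict Implicit.
Unset Printing Implicit Defensive.

Import GRing.Theory.

Local Open Scope ring_scope.
Local Open Scope complex_scope.

(* V[[x]] and V[[x, y]]: f k is the coefficient of x^k in f, and g i j the
   coefficient of x^i y^j in g (no factorials). *)
Definition pseries (V : Type) := nat -> V.
Definition pseries2 (V : Type) := nat -> nat -> V.

Section PowerSeries.
Variable V : zmodType.

Definition mul_var (f : pseries V) : pseries V :=
  fun k => if k is k'.+1 then f k' else 0.

Definition mul_var1 (g : pseries2 V) : pseries2 V :=
  fun i j => if i is i'.+1 then g i' j else 0.

Definition mul_var2 (g : pseries2 V) : pseries2 V :=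
  fun i j => if j is j'.+1 then g i j' else 0.

(* f(x + y): x^i y^j only occurs in (x + y)^(i + j). *)
Definition subst_add (f : pseries V) : pseries2 V :=
  fun i j => f (i + j)%N *+ 'C(i + j, i).

End PowerSeries.

(* A C[d]-module is a module over {poly R[i]}, with d acting as 'X and the
   scalar c as c%:P.  In the last axiom the series are in V[[lambda, mu]], in
   this order of variables: gc_act (gc_act v j) i is the coefficient of
   lambda^i mu^j in L_lambda (L_mu v), and gc_act (gc_act v i) j that in
   L_mu (L_lambda v). *)
Record gconf_module (R : realType) := GConfModule {
  gc_sort :> lmodType {poly R[i]};
  gc_act : gc_sort -> pseries gc_sort;
  gc_actD : forall (u v : gc_sort) k,
    gc_act (u + v) k = gc_act u k + gc_act v k;
  gc_actZ : forall (c : R[i]) (v : gc_sort) k,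
    gc_act (c%:P *: v) k = c%:P *: gc_act v k;
  gc_actX : forall (v : gc_sort) k,
    gc_act ('X *: v) k = 'X *: gc_act v k + mul_var (gc_act v) k;
  gc_bracket : forall (v : gc_sort) i j,
    gc_act (gc_act v j) i - gc_act (gc_act v i) j
    = mul_var1 (subst_add (gc_act v)) i j
      - mul_var2 (subst_add (gc_act v)) i j }.

Definition gc_submodule (R : realType) (V : gconf_module R) (W : set V) : Prop :=
  [/\ W 0,
      forall u v, W u -> W v -> W (u + v),
      forall (p : {poly R[i]}) v, W v -> W (p *: v)
    & forall v k, W v -> W (gc_act v k)].

Definition gc_irreducible (R : realType) (V : gconf_module R) : Prop :=
  (exists v : V, v <> 0) /\
  (forall W : set V, gc_submodule W -> W = [set 0]%classic \/ W = [set: V]%classic).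

Definition free_of_rank (A : nzRingType) (V : lmodType A) (n : nat) : Prop :=
  exists e : 'I_n -> V,
    bijective (fun a : 'rV[A]_n => \sum_(i < n) a 0 i *: e i).

(* Main.v *)
Require Import Defs.
From HB Require Import structures.
From mathcomp Require Import all_boot all_order all_algebra.
From mathcomp Require Import complex.
From mathcomp Require Import boolp classical_sets reals.

(** Let [D g = t^n g - g'] on [K[t]].  Letting [d] act as [D] and setting
    [L_lambda g = exp (lambda t) (D g)] gives a generalized conformal module,
    since [D (exp (lambda t) h) = exp (lambda t) (D h - lambda h)].  As [D]
    raises degrees by [n], the module is free over [K[d]] on
    [1, t, ..., t^(n-1)].  A submodule [W] contains [q * D w] for all [w] in [W]
    and all [q]; hence the largest ideal [J] contained in [W] contains [D W], so
    [J] is stable under [D] and therefore under [d/dt].  If [W] is nonzero, so is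
    [J], and differentiating repeatedly yields a nonzero constant in [J]. *)

Set Implicit Arguments.
Unset Strict Implicit.
Unset Printing Implicit Defensive.

Import Order.TTheory GRing.Theory Num.Theory.

Local Open Scope ring_scope.
Local Open Scope complex_scope.

Section TwistedDerivation.
Variables (K : numFieldType) (n : nat).
Implicit Types (p q : {poly K}) (c : K).

(** * The twisted derivation and its effect on degrees *)

Definition twD p : {poly K} := 'X^n * p - p^`().

Lemma twD_is_linear : linear twD.
Proof.
move=> c p q; rewrite /twD derivD derivZ mulrDr -scalerAr scalerBr opprD.
by rewrite addrACA.
Qed.

HB.instance Definition _ :=
  GRing.isLinear.Build K {poly K} {poly K} *:%R twD twD_is_linear.

(** Divided by [i!], this is the coefficient of [lambda^i] in [D (exp (lambda t) p) = exp (lambda t)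
    (D p - lambda p)]. *)
Lemma twDXn i p : twD ('X^i * p) = 'X^i * twD p - ('X^(i.-1) *+ i) * p.
Proof. by rewrite /twD derivM derivXn mulrBr mulrCA opprD addrA addrAC. Qed.

Lemma lead_twD p k : (size p <= k.+1)%N -> (0 < n)%N ->
  (size (twD p) <= (k + n).+1)%N /\ (twD p)`_(k + n) = p`_k.
Proof.
move=> sp n0; split.
  apply: leq_trans (size_polyD _ _) _; rewrite geq_max size_polyN.
  apply/andP; split.
    apply: leq_trans (size_polyMleq _ _) _; rewrite size_polyXn.
    by rewrite addSn /= addnC -addSn leq_add2r.
  apply: leq_trans (size_poly _ _) _.
  case: (size p) sp => //= s ss.
  by rewrite ltnW // (leq_trans ss) // ltnS leq_addr.
rewrite coefB coefXnM ltnNge leq_addl /= addnK coef_deriv.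
rewrite [p`__.+1]nth_default ?mul0rn ?subr0 //.
by rewrite (leq_trans sp) // ltnS leq_addr.
Qed.

(** If [p] were nonzero, [D p] would carry the leading coefficient of [p] in degree [deg p + n],
    which [r] cannot cancel. So [D] is injective even modulo polynomials of degree below [n]. *)
Lemma twD_eq0 p (r : {poly K}) : (0 < n)%N -> (size r <= n)%N ->
  twD p + r = 0 -> p = 0.
Proof.
move=> n0 sr /eqP; case: (eqVneq p 0) => // p0 /eqP e.
have sp : (size p <= (size p).-1.+1)%N by exact: leqSpred.
have [_] := lead_twD sp n0.
have /(congr1 (fun q : {poly K} => q`_((size p).-1 + n))) := e.
rewrite coefD coef0 [r`_ _]nth_default ?(leq_trans sr) ?leq_addl // addr0 => ->.
by move/esym/eqP; rewrite -lead_coefE lead_coef_eq0 (negPf p0).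
Qed.

(** * The polynomial module in which a scalar [p] acts as [p(D)] *)

Definition twmul p q : {poly K} := \sum_(i < size p) p`_i *: iter i twD q.

Lemma twmulE m p q : (size p <= m)%N ->
  twmul p q = \sum_(i < m) p`_i *: iter i twD q.
Proof.
move=> sp; rewrite /twmul (big_ord_widen _ (fun i => p`_i *: iter i twD q) sp).
rewrite big_mkcond; apply: eq_bigr => i _; case: ltnP => // si.
by rewrite nth_default // scale0r.
Qed.

Lemma twmulDl q : {morph twmul^~ q : p1 p2 / p1 + p2}.
Proof.
move=> p1 p2 /=; set m := maxn (size p1) (size p2).
rewrite !(@twmulE m) ?leq_maxl ?leq_maxr ?size_polyD // -big_split.
by apply: eq_bigr => i _; rewrite coefD scalerDl.
Qed.

Lemma twmulDr p : {morph twmul p : q1 q2 / q1 + q2}.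
Proof.
move=> q1 q2; rewrite -big_split; apply: eq_bigr => i _ /=; rewrite -scalerDr.
by congr (_ *: _); elim: (nat_of_ord i) => //= k ->; rewrite linearD.
Qed.

Lemma twmulC c q : twmul c%:P q = c *: q.
Proof. by rewrite (@twmulE 1) ?size_polyC_leq1 // big_ord1 coefC. Qed.

Lemma twmulMX p q : twmul (p * 'X) q = twD (twmul p q).
Proof.
rewrite (@twmulE (size p).+1); last first.
  by rewrite (leq_trans (size_polyMleq _ _)) // size_polyX addn2.
rewrite big_ord_recl coefMX scale0r add0r linear_sum; apply: eq_bigr => i _.
by rewrite coefMX /= linearZ.
Qed.

Lemma twmul1 : left_id 1 twmul.
Proof. by move=> q; rewrite -polyC1 twmulC scale1r. Qed.

Lemma twmulX q : twmul 'X q = twD q.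
Proof. by rewrite -['X]mul1r twmulMX twmul1. Qed.

Lemma twmulA p1 p2 q : twmul p1 (twmul p2 q) = twmul (p1 * p2) q.
Proof.
elim/poly_ind: p1 => [|p c IH].
  by rewrite mul0r -polyC0 !twmulC !scale0r.
rewrite mulrDl mulrAC !twmulDl !twmulMX IH mul_polyC twmulC; congr (_ + _).
rewrite (@twmulE (size p2) (_ *: _)) ?size_scale_leq // scaler_sumr.
by apply: eq_bigr => i _; rewrite coefZ scalerA.
Qed.

(* An alias, because here ['X] must act as [twD], not by multiplication. *)
Definition twmod : Type := {poly K}.
HB.instance Definition _ := GRing.Zmodule.on twmod.

Lemma twmulDl' (v : twmod) : {morph (twmul^~ v : _ -> twmod) : a b / a + b}.
Proof. exact: twmulDl. Qed.

HB.instance Definition _ :=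
  GRing.Zmodule_isLmodule.Build {poly K} twmod twmulA twmul1 twmulDr twmulDl'.

(** * The action [exp (lambda t) (D v)] and the conformal axioms *)

Definition twact (v : twmod) : pseries twmod :=
  fun k => (k`!%:R^-1 : K) *: ('X^k * twD v).

Lemma twactD (u v : twmod) k : twact (u + v) k = twact u k + twact v k.
Proof. by rewrite /twact linearD mulrDr scalerDr. Qed.

Lemma twactZ (c : K) (v : twmod) k : twact (c%:P *: v) k = c%:P *: twact v k.
Proof.
rewrite /twact; change (c%:P *: v) with (twmul c%:P v).
rewrite twmulC linearZ -scalerAr scalerA mulrC -scalerA.
by symmetry; exact: twmulC.
Qed.

Lemma invf_factS i : (i.+1%:R : K) * i.+1`!%:R^-1 = i`!%:R^-1.
Proof.
by rewrite factS natrM invfM mulrA mulfV ?mul1r // pnatr_eq0.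
Qed.

Lemma twactX (v : twmod) k :
  twact ('X *: v) k = 'X *: twact v k + mul_var (twact v) k.
Proof.
rewrite /twact /mul_var; change ('X *: v) with (twmul 'X v).
change ('X *: ?w) with (twmul 'X w).
rewrite !twmulX linearZ /= twDXn scalerBr.
case: k => [|k]; first by rewrite mulr0n mul0r scaler0 subr0 addr0.
by rewrite mulrnAl -scaler_nat scalerA [_^-1 * _]mulrC invf_factS subrK.
Qed.

(** Coefficientwise form of [exp ((lambda + mu) t) = exp (lambda t) exp (mu t)]. *)
Lemma invf_fact_bin i j :
  (('C(i + j, i))%:R : K) * (i + j)`!%:R^-1 = i`!%:R^-1 * j`!%:R^-1.
Proof.
have f0 k : (k`!%:R : K) != 0 by rewrite pnatr_eq0 -lt0n fact_gt0.
rewrite -invfM -natrM; apply: (mulIf (f0 (i + j)%N)); rewrite divfK ?f0 //.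
have := bin_fact (leq_addr j i); rewrite addKn => <-.
by rewrite !natrM mulrCA mulVf ?mulr1 ?mulf_neq0.
Qed.

(** Coefficient of [lambda^i mu^j] in [L_lambda (L_mu v) = exp ((lambda + mu) t) (D (D v)) - mu
    L_(lambda + mu) v]. The first term is symmetric in [lambda] and [mu], so it cancels in the
    bracket. *)
Lemma twact_twact (v : twmod) i j :
  twact (twact v j) i = (i`!%:R^-1 * j`!%:R^-1 : K) *: ('X^(i + j) * twD (twD v))
    - mul_var2 (subst_add (twact v)) i j.
Proof.
rewrite {1}/twact linearZ /= twDXn -scalerAr scalerA mulrBr !mulrA -exprD scalerBr.
congr (_ - _); rewrite /mul_var2; case: j => [|j].
  by rewrite mulr0n mulr0 mul0r scaler0.
rewrite /subst_add /twact mulrnAr -exprD mulrnAl -(scaler_nat j.+1).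
rewrite -[RHS](@scaler_nat K {poly K}) !scalerA.
by rewrite invf_fact_bin -mulrA [_^-1 * j.+1%:R]mulrC invf_factS.
Qed.

Lemma mul_var_subst_addC (V : zmodType) (f : pseries V) i j :
  mul_var2 (subst_add f) j i = mul_var1 (subst_add f) i j.
Proof.
case: i => //= i; rewrite /subst_add addnC; congr (_ *+ _).
by rewrite -[RHS]bin_sub ?leq_addr // addKn.
Qed.

Lemma twact_bracket (v : twmod) i j :
  twact (twact v j) i - twact (twact v i) j
  = mul_var1 (subst_add (twact v)) i j - mul_var2 (subst_add (twact v)) i j.
Proof.
rewrite (twact_twact v i j) (twact_twact v j i) !mul_var_subst_addC.
by rewrite [(j + i)%N]addnC [j`!%:R^-1 * _]mulrC opprB addrC addrA subrK.
Qed.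

(** * Irreducibility *)

Lemma twact_simple (W : set twmod) :
  W 0 -> (forall u v, W u -> W v -> W (u + v)) ->
  (forall c v, W v -> W (c%:P *: v)) -> (forall v k, W v -> W (twact v k)) ->
  (exists2 w, W w & twD w != 0) -> forall v, W v.
Proof.
move=> W0 WD WZ Wact [w Ww Dw0] v.
have WC c (u : twmod) : W u -> W ((c *: (u : {poly K})) : twmod).
  by move=> /(WZ c); change (c%:P *: u) with (twmul c%:P u); rewrite twmulC.
have WM u : W u -> forall q, W (q * twD u).
  move=> Wu q; rewrite -[q]coefK poly_def mulr_suml.
  elim/big_ind: _ => // i _; rewrite -scalerAl.
  (* The action yields [t^i D u / i!]; the factor [i!] clears the denominator. *)
  have /(WC (q`_i * i`!%:R)) := Wact u i Wu.
  by rewrite /twact scalerA mulfK // pnatr_eq0 -lt0n fact_gt0.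
(* The largest ideal of [K[t]] contained in [W]. *)
pose J p := forall q, W (q * p).
have Jder p : J p -> J p^`().
  move=> Jp q; have Wp : W p by rewrite -[p]mul1r; exact: Jp.
  have -> : q * p^`() = q * 'X^n * p + (-1) *: (q * twD p).
    by rewrite scaleN1r /twD mulrBr opprB mulrA addrC subrK.
  by apply: WD; [exact: Jp | apply/WC/WM].
(* Induction on the degree [m] of [p]: in characteristic zero the derivative lowers it by exactly
   one, and a nonzero constant in [J] puts every [v] in [W]. *)
have Jtop m p : size p = m.+1 -> J p -> W v.
  elim: m p => [|m IH] p sp Jp.
    have /size_poly1P[c c0 ep] : size p == 1%N by rewrite sp.
    have := Jp ((v : {poly K}) * c^-1%:P).
    by rewrite ep -mulrA -polyCM mulVf // mulr1.
  apply: IH (Jder p Jp).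
  apply/eqP; rewrite eqn_leq; apply/andP; split.
    by rewrite (leq_trans (size_poly _ _)) // sp.
  rewrite ltnNge; apply/negP => le.
  have /eqP := nth_default 0 le; rewrite coef_deriv mulrn_eq0 /=.
  have -> : p`_m.+1 = lead_coef p by rewrite lead_coefE sp.
  by rewrite lead_coef_eq0 -size_poly_eq0 sp.
apply: (Jtop (size (twD w)).-1 (twD w)); last exact: WM.
by rewrite prednK // lt0n size_poly_eq0.
Qed.

(** * Freeness on the monomials of degree below [n] *)

Definition twcomb (a : 'rV[{poly K}]_n) : twmod :=
  \sum_(i < n) a 0 i *: ('X^i : twmod).

Lemma twcombD : {morph twcomb : a b / a + b}.
Proof.
by move=> a b; rewrite -big_split; apply: eq_bigr => i _; rewrite mxE scalerDl.
Qed.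

Lemma twcombX a : twcomb ('X *: a) = twD (twcomb a).
Proof.
rewrite -twmulX; change (twmul 'X ?w) with ('X *: (w : twmod)).
by rewrite scaler_sumr; apply: eq_bigr => i _; rewrite mxE scalerA.
Qed.

Lemma twcombC (c : 'I_n -> K) :
  twcomb (\row_i (c i)%:P) = \sum_(i < n) c i *: ('X^i : {poly K}).
Proof. by apply: eq_bigr => i _; rewrite mxE; exact: twmulC. Qed.

Lemma coef_sumXn (c : 'I_n -> K) (j : 'I_n) :
  (\sum_(i < n) c i *: ('X^i : {poly K}))`_j = c j.
Proof.
rewrite coef_sum (bigD1 j) //= coefZ coefXn eqxx mulr1 big1 ?addr0 // => i ij.
by rewrite coefZ coefXn -val_eqE /= eq_sym in ij *; rewrite (negPf ij) mulr0.
Qed.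

Lemma size_sumXn (c : 'I_n -> K) :
  (size (\sum_(i < n) c i *: ('X^i : {poly K}))%R <= n)%N.
Proof.
apply/leq_sizeP => j nj; rewrite coef_sum big1 // => i _.
by rewrite coefZ coefXn gtn_eqF ?mulr0 // (leq_trans (ltn_ord i)).
Qed.

(** Splitting [a] into ['X *: b] and constant terms turns the relation into [D (twcomb b) + r = 0]
    with [deg r < n]. Then [twD_eq0] gives [twcomb b = 0], hence [r = 0], and the induction applies
    to [b]. *)
Lemma twcomb_eq0 a : (0 < n)%N -> twcomb a = 0 -> a = 0.
Proof.
move=> n0; have [m sa] : exists m, forall i, (size (a 0%R i) <= m)%N.
  by exists (\max_i size (a 0%R i)) => i; exact: (leq_bigmax i).
elim: m a sa => [|m IH] a sa a0.
  by apply/rowP => i; rewrite mxE; apply/eqP; rewrite -size_poly_leq0.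
pose b := \row_i drop_poly 1 (a 0 i).
pose c i := (a 0 i)`_0.
have ea : a = 'X *: b + \row_i (c i)%:P.
  apply/rowP => i; rewrite !mxE mulrC; apply/polyP => -[|k].
    by rewrite coefD coefMX coefC add0r.
  by rewrite coefD coefMX coefC addr0 coef_drop_poly addn1.
have e0 := a0; rewrite ea twcombD twcombX twcombC in e0.
have tb0 := twD_eq0 n0 (size_sumXn c) e0.
have {}IH : b = 0.
  by apply: IH tb0 => i; rewrite mxE size_drop_poly leq_subLR.
rewrite tb0 linear0 add0r in e0.
rewrite ea IH scaler0 add0r; apply/rowP => i; rewrite !mxE.
by rewrite -(coef_sumXn c i) e0 coef0.
Qed.

Lemma twcomb_onto v : (0 < n)%N -> exists a, twcomb a = v.
Proof.
move=> n0; have [m] := ubnP (size (v : {poly K})).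
elim: m v => // m IH v; rewrite ltnS => sv.
have [vn|nv] := leqP (size (v : {poly K})) n.
  exists (\row_(i < n) ((v : {poly K})`_i)%:P); rewrite twcombC -poly_def.
  apply/polyP => i; rewrite coef_poly; case: ltnP => // ni.
  by rewrite nth_default // (leq_trans vn).
set d := (size (v : {poly K})).-1; have sd : size (v : {poly K}) = d.+1.
  by rewrite prednK // (leq_trans _ nv).
rewrite sd ltnS in nv sv.
(* Division step: [D h] has the same leading term as [v], so [h] and [v - D h] both have degree
   below [d], the former because [n > 0]. *)
pose h : {poly K} := (v : {poly K})`_d *: 'X^(d - n).
have sh : (size h <= (d - n).+1)%N.
  by rewrite (leq_trans (size_scale_leq _ _)) // size_polyXn.
have [sDh hd] := lead_twD sh n0.
rewrite subnK // in sDh hd.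
have [|a ea] := IH h.
  apply: leq_ltn_trans sh _; rewrite (leq_trans _ sv) //.
  by rewrite ltnS ltn_subrL n0 (leq_trans n0).
have [|b eb] := IH ((v : {poly K}) - twD h).
  rewrite (leq_ltn_trans _ sv) //; apply/leq_sizeP => j; rewrite leq_eqVlt coefB.
  case/orP => [/eqP<-|dj]; first by rewrite hd coefZ coefXn eqxx mulr1 subrr.
  by rewrite !nth_default ?subrr ?sd // (leq_trans sDh).
by exists ('X *: a + b); rewrite twcombD twcombX ea eb addrC subrK.
Qed.

Lemma twmod_free : (0 < n)%N -> free_of_rank twmod n.
Proof.
move=> n0; exists (fun i => 'X^i : {poly K}).
have [g gK] := choice (fun v => twcomb_onto v n0).
have inj a b : twcomb a = twcomb b -> a = b.
  move=> ab; apply/eqP; rewrite -subr_eq0; apply/eqP/twcomb_eq0 => //.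
  by apply: (addIr (twcomb b)); rewrite -twcombD subrK add0r.
by exists g => // a; apply: inj; rewrite gK.
Qed.

End TwistedDerivation.

Theorem theorem4p27 (R : realType) (n : nat) (hn : (1 <= n)%N) :
  exists V : gconf_module R, gc_irreducible V /\ free_of_rank V n.
Proof.
pose V := GConfModule (@twactD R[i] n) (@twactZ R[i] n) (@twactX R[i] n)
  (@twact_bracket R[i] n).
(* Injectivity of [D] is [twD_eq0] with zero remainder; it makes [twact_simple] apply to any nonzero
   submodule. *)
have D0 (w : V) : w != 0 -> twD n w != 0.
  by apply: contra_neq => e; apply: (@twD_eq0 _ n _ 0); rewrite ?size_poly0 ?addr0.
exists V; split; last exact: twmod_free.
split; first by exists (1 : {poly R[i]}); apply/eqP; exact: oner_neq0.
move=> W [W0 WD WZ Wact].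
have [[w [Ww w0]]|W_0] := pselect (exists w, W w /\ w != 0).
  right; apply/seteqP; split=> // v _.
  apply: (@twact_simple R[i] n W) => // [c u Wu|]; first exact: WZ.
  by exists w => //; exact: D0.
left; apply/seteqP; split=> [v Wv|_ ->] //=.
by apply/eqP/negP => v0; apply: W_0; exists v; split=> //; apply/negP.
Qed.
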